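(* Assume that for every $i\in\mathcal S$ the coefficients $A(\cdot,i),B(\cdot,i),C(\cdot,i),D(\cdot,i),Q(\cdot,i),S(\cdot,i),R(\cdot,i)$ are bounded and $\mathbb F^W$-progressively measurable, $G(i)$ is bounded and $\mathscr F^W_T$-measurable, and $Q(\cdot,i),R(\cdot,i),G(i)$ are symmetric. For any given initial triple $(t,\xi,\vartheta)\in\mathcal D$, a control $u^*(\cdot)\in\mathcal U[t,T]$ is optimal for Problem (M-SLQ)$_0$ if and only if it is optimal for Problem (M-SLQ).
   Context: Fix $T>0$ and positive integers $n,m,L$. $(\Omega,\mathscr F,\mathbb F,\mathbb P)$ is a complete filtered probability space carrying a standard one-dimensional Brownian motion $W$ and an independent continuous-time Markov chain $\alpha$ with finite state space $\mathcal S=\{1,\dots,L\}$ and generator $[\lambda_{kl}(t)]_{k,l\in\mathcal S}$. $\mathbb F=\{\mathscr F_t\}$ is the natural filtration of $(W,\alpha)$, with $\mathscr F_0$ containing all $\mathbb P$-null sets; $\mathbb F^W=\{\mathscr F^W_t\}$ and $\mathbb F^\alpha=\{\mathscr F^\alpha_t\}$ are the filtrations generated by $W$ and by $\alpha$. $L^2_{\mathbb F}(t,T;\mathbb H)$ is the set of $\mathbb H$-valued $\mathbb F$-progressively measurable processes $\phi$ with $\mathbb E\int_t^T|\phi|^2ds<\infty$. $A(s,i),C(s,i)$ are $\mathbb R^{n\times n}$-valued, $B(s,i),D(s,i)$ are $\mathbb R^{n\times m}$-valued, $Q(s,i)$ and $G(i)$ are $\mathbb R^{n\times n}$-valued, $S(s,i)$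 is $\mathbb R^{m\times n}$-valued and $R(s,i)$ is $\mathbb R^{m\times m}$-valued; all are random. $\mathcal D$ is the set of initial triples $(t,\xi,\vartheta)$ with $t\in[0,T]$, $\xi\in L^2_{\mathscr F_t}(\Omega;\mathbb R^n)$, $\vartheta\in L^2_{\mathscr F^\alpha_t}(\Omega;\mathcal S)$; $\mathcal U[t,T]=L^2_{\mathbb F}(t,T;\mathbb R^m)$. For $(t,\xi,\vartheta)\in\mathcal D$ and $u\in\mathcal U[t,T]$ the state $X$ solves $$dX=[A(s,\alpha(s))X+B(s,\alpha(s))u]ds+[C(s,\alpha(s))X+D(s,\alpha(s))u]dW(s),\quad X(t)=\xi,\ \alpha(t)=\vartheta,$$ and the cost functional is $$J(t,\xi,\vartheta;u)=\mathbb E\Big[\langle G(\alpha(T))X(T),X(T)\rangle+\int_t^T\big\{\langle QX,X\rangle+2\langle SX,u\rangle+\langle Ru,u\rangle\big\}ds\,\Big|\,\mathscr F_t\Big],$$ with $Q,S,R$ evaluated at $(s,\alpha(s))$; $J_0(t,\xi,\vartheta;u)$ is the same expression with the conditional expectation replaced by the expectation $\mathbb E$. Problem (M-SLQ): given $(t,\xi,\vartheta)\in\mathcal D$, find $u^*\in\mathcal U[t,T]$ with $J(t,\xi,\vartheta;u^* )=\operatorname{ess\,inf}_{u\in\mathcal U[t,T]}J(t,\xi,\vartheta;u)$, i.e. $J(t,\xi,\vartheta;u^* )\le J(t,\xi,\vartheta;u)$ a.s. for all $u\in\mathcal U[t,T]$. Problem (M-SLQ)$_0$: find $u^*\in\mathcal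 U[t,T]$ minimizing $J_0(t,\xi,\vartheta;u)$ over $u\in\mathcal U[t,T]$. *)

(* Defs.v *)
From HB Require Import structures.
From mathcomp Require Import all_boot all_order all_algebra.
From mathcomp Require Import all_classical all_reals all_analysis.
Set Implicit Arguments.
Unset Strict Implicit.
Unset Printing Implicit Defensive.
Import Order.TTheory GRing.Theory Num.Theory numFieldNormedType.Exports.
Local Open Scope classical_set_scope.
Local Open Scope ring_scope.

Definition dotc (R : realType) (k : nat) (x y : 'cV[R]_k) : R :=
  \sum_(i < k) x i 0 * y i 0.

Section sub_sigma_algebras.
Context d (Omega : measurableType d) (R : realType) (P : probability Omega R).
Implicit Types (G C : set (set Omega)) (F : R -> set (set Omega)).

Definition augmented C : set (set Omega) := <<s C `|` P.-negligible >>.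

(* For a sigma-algebra G, the measurable sets of [g_sigma_algebraType G] are
   exactly those of G. *)
Definition measurable_wrt G (f : Omega -> R) : Prop :=
  measurable_fun [set: g_sigma_algebraType G] f.

Definition is_cond_exp G (X Y : Omega -> R) : Prop :=
  [/\ measurable_wrt G Y,
      P.-integrable [set: Omega] (EFin \o Y) &
      forall A, G A ->
        (\int[P]_(w in A) (Y w)%:E = \int[P]_(w in A) (X w)%:E)%E].

(* E[X | G], as a chosen version; versions are unique up to P-null sets, and
   one exists as soon as X is P-integrable. *)
Definition cond_exp G (X : Omega -> R) : Omega -> R :=
  xget (cst 0) [set Y | is_cond_exp G X Y].

Definition L2_rv G (k : nat) (xi : Omega -> 'cV[R]_k) : Prop :=
  (forall i, measurable_wrt G (fun w => xi w i 0)) /\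
  (\int[P]_w (dotc (xi w) (xi w))%:E < +oo)%E.

(* For each r in [t, T], the restriction of phi to [t, r] x Omega is
   B([t, r]) (x) F r - measurable (entrywise, for matrices). *)
Definition prog_measurable F (t T : R) (p q : nat)
    (phi : R -> Omega -> 'M[R]_(p, q)) : Prop :=
  forall r, t <= r <= T -> forall i j,
    measurable_fun (`[t, r] `*` [set: g_sigma_algebraType (F r)])
      (fun z : measurableTypeR R * g_sigma_algebraType (F r) =>
         phi z.1 z.2 i j).

Definition L2_prog F (t T : R) (k : nat) (phi : R -> Omega -> 'cV[R]_k) : Prop :=
  prog_measurable F t T phi /\
  (\int[P]_w \int[lebesgue_measure]_(s in `[t, T])
     (dotc (phi s w) (phi s w))%:E < +oo)%E.

End sub_sigma_algebras.

Section driving_processes.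
Context d (Omega : measurableType d) (R : realType) (P : probability Omega R).
Context (L : nat) (T : R).
Variables (W : R -> Omega -> R) (alpha : R -> Omega -> 'I_L).

Definition W_events (t : R) : set (set Omega) :=
  [set A | exists s B, [/\ 0 <= s <= t, measurable B & A = W s @^-1` B]].

Definition alpha_events (t : R) : set (set Omega) :=
  [set A | exists s i, 0 <= s <= t /\ A = alpha s @^-1` [set i]].

(* The three filtrations are augmented by the P-null sets. *)
Definition filtrW (t : R) := augmented P (W_events t).
Definition filtrA (t : R) := augmented P (alpha_events t).
Definition filtr (t : R) := augmented P (W_events t `|` alpha_events t).

Record brownian_motion : Prop := BrownianMotion {
  bm_measurable : forall (t : R), 0 <= t <= T -> measurable_fun setT (W t) ;
  bm_start : {ae P, forall w, W 0 w = 0} ;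
  bm_continuous :
    {ae P, forall w, {within `[0, T], continuous (fun t => W t w)}} ;
  bm_gaussian : forall (s t : R), 0 <= s -> s < t -> t <= T ->
    forall B : set R, measurable B ->
      P [set w | B (W t w - W s w)] = normal_prob 0 (Num.sqrt (t - s)) B ;
  bm_independent : forall (s t : R), 0 <= s -> s < t -> t <= T ->
    forall A (B : set R), filtrW s A -> measurable B ->
      P (A `&` [set w | B (W t w - W s w)]) =
      (P A * P [set w | B (W t w - W s w)%R])%E }.

Variable lambda : R -> 'M[R]_L.

Record generator : Prop := Generator {
  gen_offdiag : forall (t : R) k l, 0 <= t <= T -> k != l -> 0 <= lambda t k l ;
  gen_rowsum : forall (t : R) k, 0 <= t <= T -> \sum_l lambda t k l = 0 ;
  gen_integrable : forall k l,
    lebesgue_measure.-integrable `[0, T] (fun t => (lambda t k l)%:E) }.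

(* [p s t k l] is the probability of being in l at time t given state k at
   time s.  No regularity of lambda beyond integrability being assumed, the
   infinitesimal description  p s (s + h) = 1 + h lambda(s) + o(h)  is taken
   in the integrated form of the forward Kolmogorov equation. *)
Record transition_function (p : R -> R -> 'M[R]_L) : Prop := TransitionFunction {
  trans_integrable : forall (s : R) k l, 0 <= s <= T ->
    lebesgue_measure.-integrable `[s, T]
      (fun r => ((p s r *m lambda r) k l)%:E) ;
  trans_forward : forall (s t : R) k l, 0 <= s -> s <= t -> t <= T ->
    p s t k l = (k == l)%:R +
      \int[lebesgue_measure]_(r in `[s, t]) (p s r *m lambda r) k l }.

(* Every path, not only almost every one, is right-continuous with left limits
   (for the discrete topology), so that alpha is progressively measurable. *)
Record markov_chain : Prop := MarkovChain {
  mc_measurable : forall (t : R) i, 0 <= t <= T -> measurable (alpha t @^-1` [set i]) ;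
  mc_right_continuous : forall w (t : R), 0 <= t < T ->
    \forall s \near t^'+, alpha s w = alpha t w ;
  mc_left_limits : forall w (t : R), 0 < t <= T ->
    exists i, \forall s \near t^'-, alpha s w = i ;
  mc_generator : generator ;
  mc_markov : exists2 p, transition_function p &
    forall (s t : R) l A, 0 <= s -> s <= t -> t <= T -> filtrA s A ->
      (P (A `&` alpha t @^-1` [set l]) =
       \int[P]_(w in A) (p s t (alpha s w) l)%:E)%E }.

Definition independent_drivers : Prop :=
  forall A B, filtrW T A -> filtrA T B -> P (A `&` B) = (P A * P B)%E.

(* A simple process on [t, s] is a finite sum of terms
   eta(w) 1_{]a, b]}(r), t <= a <= b <= s, with eta bounded and F a -
   measurable; it is encoded by the list of the triples (a, b, eta). *)
Definition simple_process := seq (R * R * (Omega -> R)).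

Definition simple_adapted (t s : R) (H : simple_process) : Prop :=
  forall i, (i < size H)%N ->
    let: (a, b, eta) := nth (t, t, cst 0) H i in
    [/\ t <= a, a <= b, b <= s, measurable_wrt (filtr a) eta &
        exists M, forall w, `|eta w| <= M].

Definition simple_val (H : simple_process) (r : R) (w : Omega) : R :=
  \sum_(e <- H) e.2 w * \1_(`]e.1.1, e.1.2]) r.

Definition simple_integral (H : simple_process) (w : Omega) : R :=
  \sum_(e <- H) e.2 w * (W e.1.2 w - W e.1.1 w).

(* I is (a version of) the Ito integral of phi over [t, s] with respect to W:
   the L2(P)-limit of the integrals of simple processes that converge to phi
   in L2(dr x dP). *)
Definition is_ito_integral (t s : R) (phi : R -> Omega -> R) (I : Omega -> R) :
    Prop :=
  [/\ measurable_wrt (filtr s) I,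
      (\int[P]_w ((I w) ^+ 2)%:E < +oo)%E &
      exists H : nat -> simple_process,
      [/\ forall k, simple_adapted t s (H k),
          (fun k => (\int[P]_w \int[lebesgue_measure]_(r in `[t, s])
             ((simple_val (H k) r w - phi r w) ^+ 2)%:E)%E) @ \oo --> 0%E &
          (fun k => (\int[P]_w ((simple_integral (H k) w - I w) ^+ 2)%:E)%E)
             @ \oo --> 0%E]].

End driving_processes.

Record lq_data (R : realType) (Omega : Type) (n m L : nat) := LQData {
  cA : R -> 'I_L -> Omega -> 'M[R]_n ;
  cB : R -> 'I_L -> Omega -> 'M[R]_(n, m) ;
  cC : R -> 'I_L -> Omega -> 'M[R]_n ;
  cD : R -> 'I_L -> Omega -> 'M[R]_(n, m) ;
  cQ : R -> 'I_L -> Omega -> 'M[R]_n ;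
  cS : R -> 'I_L -> Omega -> 'M[R]_(m, n) ;
  cR : R -> 'I_L -> Omega -> 'M[R]_m ;
  cG : 'I_L -> Omega -> 'M[R]_n }.

Section lq_problem.
Context d (Omega : measurableType d) (R : realType) (P : probability Omega R).
Context (n m L : nat) (T : R).
Variables (W : R -> Omega -> R) (alpha : R -> Omega -> 'I_L).
Variable K : lq_data R Omega n m L.

Definition bounded_coef (p q : nat) (phi : R -> Omega -> 'M[R]_(p, q)) : Prop :=
  exists M, forall s w i j, 0 <= s <= T -> `|phi s w i j| <= M.

Definition admissible_coef (p q : nat) (phi : R -> Omega -> 'M[R]_(p, q)) : Prop :=
  bounded_coef phi /\ prog_measurable (filtrW P W) 0 T phi.

Record lq_assumptions : Prop := LQAssumptions {
  lq_A : forall i, admissible_coef (fun s => cA K s i) ;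
  lq_B : forall i, admissible_coef (fun s => cB K s i) ;
  lq_C : forall i, admissible_coef (fun s => cC K s i) ;
  lq_D : forall i, admissible_coef (fun s => cD K s i) ;
  lq_Q : forall i, admissible_coef (fun s => cQ K s i) ;
  lq_S : forall i, admissible_coef (fun s => cS K s i) ;
  lq_R : forall i, admissible_coef (fun s => cR K s i) ;
  lq_G_bounded : forall i, exists M, forall w j k, `|cG K i w j k| <= M ;
  lq_G_measurable : forall i j k,
    measurable_wrt (filtrW P W T) (fun w => cG K i w j k) ;
  lq_Q_sym : forall s i w, 0 <= s <= T -> (cQ K s i w)^T = cQ K s i w ;
  lq_R_sym : forall s i w, 0 <= s <= T -> (cR K s i w)^T = cR K s i w ;
  lq_G_sym : forall i w, (cG K i w)^T = cG K i w }.

Definition initial_triple (t : R) (xi : Omega -> 'cV[R]_n)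
    (vartheta : Omega -> 'I_L) : Prop :=
  [/\ 0 <= t <= T, L2_rv P (filtr P W alpha t) xi &
      forall i, filtrA P alpha t (vartheta @^-1` [set i])].

Definition controls (t : R) (u : R -> Omega -> 'cV[R]_m) : Prop :=
  L2_prog P (filtr P W alpha) t T u.

Section cost.
Variables (t : R) (xi : Omega -> 'cV[R]_n) (vartheta : Omega -> 'I_L).

Definition drift (u : R -> Omega -> 'cV[R]_m) (X : R -> Omega -> 'cV[R]_n)
    (s : R) (w : Omega) : 'cV[R]_n :=
  cA K s (alpha s w) w *m X s w + cB K s (alpha s w) w *m u s w.

Definition diffusion (u : R -> Omega -> 'cV[R]_m) (X : R -> Omega -> 'cV[R]_n)
    (s : R) (w : Omega) : 'cV[R]_n :=
  cC K s (alpha s w) w *m X s w + cD K s (alpha s w) w *m u s w.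

(* The initial condition X(t) = xi is the integral equation at s = t. *)
Definition is_state (u : R -> Omega -> 'cV[R]_m) (X : R -> Omega -> 'cV[R]_n) :
    Prop :=
  [/\ L2_prog P (filtr P W alpha) t T X,
      {ae P, forall w, {within `[t, T], continuous (fun s => X s w)}},
      {ae P, forall w, alpha t w = vartheta w} &
      forall s, t <= s <= T -> exists2 I : Omega -> 'cV[R]_n,
        forall i, is_ito_integral P W alpha t s
          (fun r w => diffusion u X r w i 0) (fun w => I w i 0) &
        {ae P, forall w, X s w = xi w +
          \col_i \int[lebesgue_measure]_(r in `[t, s]) drift u X r w i 0
          + I w}].

Definition running_cost (u : R -> Omega -> 'cV[R]_m)
    (X : R -> Omega -> 'cV[R]_n) (s : R) (w : Omega) : R :=
  dotc (cQ K s (alpha s w) w *m X s w) (X s w)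
  + 2 * dotc (cS K s (alpha s w) w *m X s w) (u s w)
  + dotc (cR K s (alpha s w) w *m u s w) (u s w).

Definition pathwise_cost (u : R -> Omega -> 'cV[R]_m)
    (X : R -> Omega -> 'cV[R]_n) (w : Omega) : R :=
  dotc (cG K (alpha T w) w *m X T w) (X T w)
  + \int[lebesgue_measure]_(s in `[t, T]) running_cost u X s w.

Definition J (u : R -> Omega -> 'cV[R]_m) (X : R -> Omega -> 'cV[R]_n) :
    Omega -> R :=
  cond_exp P (filtr P W alpha t) (pathwise_cost u X).

Definition J0 (u : R -> Omega -> 'cV[R]_m) (X : R -> Omega -> 'cV[R]_n) :
    \bar R :=
  ('E_P[pathwise_cost u X])%E.

(* The cost of a control is that of its state process, which is a solution of
   the state equation and is unique up to indistinguishability. *)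
Definition optimal_MSLQ (us : R -> Omega -> 'cV[R]_m) : Prop :=
  controls t us /\
  exists2 Xs, is_state us Xs &
    forall u X, controls t u -> is_state u X ->
      {ae P, forall w, J us Xs w <= J u X w}.

Definition optimal_MSLQ0 (us : R -> Omega -> 'cV[R]_m) : Prop :=
  controls t us /\
  exists2 Xs, is_state us Xs &
    forall u X, controls t u -> is_state u X -> (J0 us Xs <= J0 u X)%E.

End cost.
End lq_problem.

(* Main.v *)
Require Import Defs.
From HB Require Import structures.
From mathcomp Require Import all_boot all_order all_algebra.
From mathcomp Require Import all_classical all_reals all_analysis.
From mathcomp Require Import measurable_realfun ring lra.
Set Implicit Arguments.
Unset Strict Implicit.
Unset Printing Implicit Defensive.
Import Order.TTheory GRing.Theory Num.Theory numFieldNormedType.Exports.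
Local Open Scope classical_set_scope.
Local Open Scope ring_scope.

(** The implication from the conditional problem to the unconditional one is
    integration: the expectation of J(t, xi, vartheta; u) is J_0(t, xi,
    vartheta; u), so an almost sure inequality between conditional costs passes
    to the expected costs.

    The converse is a pasting argument.  Let v be optimal in expectation, with
    state Y, and let u be a competitor, with state X.  The set A on which
    J(u) < J(v) belongs to F_t, so the control equal to u on A and to v off A is
    still progressively measurable on [t, T]; because A is decided at the
    initial time, the process equal to X on A and to Y off A solves its state
    equation ([is_state_glue]).  The Ito integral is the only term of that
    equation that is not computed path by path: there, multiplying the
    coefficients of the approximating simple processes by the indicators of A
    and of its complement keeps them adapted, since no partition interval starts
    before t ([is_ito_integral_glue]).  The cost of the pasted control is the
    pasting of the two costs ([pathwise_cost_glue]), so optimality of v gives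
    E[1_A cost(v)] <= E[1_A cost(u)], that is E[1_A (J(v) - J(u))] <= 0.  The
    integrand is positive on A, hence P(A) = 0
    ([glue_expectation_le_cond_exp_ae]).

    Both directions need the conditional costs to be genuine conditional
    expectations, hence the cost to be integrable ([integrable_pathwise_cost])
    and conditional expectations to exist ([cond_exp_exists], by
    Radon-Nikodym).  Integrability of the cost reduces to square integrability
    of the control and the state on [t, T] x Omega and of the terminal state;
    the latter is read off the state equation at time T, whose drift term is
    controlled by the Cauchy-Schwarz inequality in time
    ([sq_integrable_time_integral]).  The coefficients evaluated along the
    chain are jointly measurable because the chain is right-continuous
    ([measurable_strip_right_continuous]). *)

(** * Conditional expectations *)

Section sub_sigma.
Context d (Omega : measurableType d) (R : realType) (P : probability Omega R).
Variable G : set (set Omega).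
Hypothesis GM : G `<=` measurable.

(** Turns measurability for the coarser sigma-algebra [G] into measurability on
    [Omega], by composition. *)
Lemma measurable_idfun_sub :
  measurable_fun setT (idfun : Omega -> g_sigma_algebraType G).
Proof.
move=> _ B mB; rewrite setTI.
exact: (smallest_sub (sigma_algebra_measurable Omega) GM mB).
Qed.

Lemma measurable_wrt_measurable (Y : Omega -> R) :
  measurable_wrt G Y -> measurable_fun setT Y.
Proof. by move=> mY; exact: (measurableT_comp mY measurable_idfun_sub). Qed.

Let id_sub : Omega -> g_sigma_algebraType G := idfun.
HB.instance Definition _ := isMeasurableFun.Build _ _ _ _ id_sub
  measurable_idfun_sub.

(** The conditional expectation is the density, with respect to the restriction
    of [P] to [G], of the restriction to [G] of the signed measure with density
    [X]; the restriction of [P] is realized as the law of the identity map from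
    [Omega] to [Omega] equipped with [G]. *)
Lemma cond_exp_exists (X : Omega -> R) : sigma_algebra setT G ->
  P.-integrable setT (EFin \o X) -> exists Y, is_cond_exp P G X Y.
Proof.
move=> sG iX.
pose nu0 : set (g_sigma_algebraType G) -> \bar R := induced_charge iX.
have subM (A : set (g_sigma_algebraType G)) : measurable A ->
    measurable (A : set Omega).
  by rewrite measurable_g_measurableTypeE//; exact: GM.
have nu0_0 : nu0 set0 = 0%E by exact: charge0.
have nu0_fin A : measurable A -> nu0 A \is a fin_num.
  by move=> /subM mA; exact: fin_num_measure.
have nu0_add : semi_sigma_additive nu0.
  move=> F mF tF mUF; apply: charge_semi_sigma_additive => //; last exact: subM.
  by move=> n; exact: subM.
pose nu : {charge set (g_sigma_algebraType G) -> \bar R} :=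
  HB.pack nu0 (isCharge.Build _ _ _ nu0 nu0_0 nu0_fin nu0_add).
pose mu := distribution P id_sub.
have numu : nu `<< mu.
  apply/null_content_dominatesP => A /subM mA muA.
  apply: (@null_set_integral _ _ _ P) => //.
  exact: measurable_funS (measurable_int P iX).
have iY := Radon_Nikodym_integrable numu.
have Yfin x := Radon_Nikodym_fin_num x numu.
have YE A mA := Radon_Nikodym_integral (A := A) numu mA.
move: iY Yfin YE; set Y := Radon_Nikodym _ _ => iY Yfin YE.
have mY : measurable_fun setT Y := measurable_int _ iY.
have EY : EFin \o (fine \o Y) = Y by apply/funext => x /=; rewrite fineK.
have iPY : P.-integrable setT (Y \o id_sub).
  apply/integrableP; split.
    exact: measurableT_comp mY measurable_idfun_sub.
  have /integrableP[_] := iY.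
  rewrite (ge0_integral_pushforward measurable_idfun_sub)//.
  exact: measurableT_comp.
exists (fine \o Y); split.
- exact: measurableT_comp.
- by rewrite EY.
move=> A GA; have mA : measurable (A : set (g_sigma_algebraType G)).
  by rewrite measurable_g_measurableTypeE.
have -> : (\int[P]_(w in A) (X w)%:E)%E = nu A by [].
rewrite YE//.
rewrite /mu/= integral_pushforward//.
- by apply: eq_integral => x _ /=; rewrite fineK.
- by apply: integrableS iPY => //; exact: GM.
Qed.

End sub_sigma.

(** * Integrals of nonnegative functions without measurability *)

Section nneg_integral_glue.
Import HBNNSimple.
Context d (T : measurableType d) (R : realType) (mu : {measure set T -> \bar R}).

(** The integral of a nonnegative function is a supremum over the simple
    functions below it, hence monotone even for non-measurable functions.  This
    is used for iterated integrals, whose inner integral is not a priori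
    measurable. *)
Lemma nneg_le_integral (D : set T) (f g : T -> \bar R) :
  (forall x, D x -> 0 <= f x)%E -> (forall x, D x -> f x <= g x)%E ->
  (\int[mu]_(x in D) f x <= \int[mu]_(x in D) g x)%E.
Proof.
move=> f0 fg; have g0 x : D x -> (0 <= g x)%E.
  by move=> Dx; exact: le_trans (f0 x Dx) (fg x Dx).
rewrite !ge0_integralE//; apply: ge_ereal_sup => _ [h /= hf <-].
apply: ereal_sup_ubound; exists h => // x; apply: le_trans (hf x) _.
by rewrite !patchE; case: ifPn => // /set_mem; exact: fg.
Qed.

Let nneg_integral_part_le (B : set T) (f g : T -> \bar R) :
  (forall x, 0 <= f x)%E -> (forall x, 0 <= g x)%E ->
  (forall x, B x -> f x <= g x)%E ->
  (\int[mu]_(x in B) f x <= \int[mu]_x g x)%E.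
Proof.
move=> f0 g0 fg; rewrite integral_mkcond; apply: nneg_le_integral => x _;
  by rewrite patchE; case: ifPn => // /set_mem; exact: fg.
Qed.

(** Only simple functions below [f] are integrated over [A] and over its
    complement separately, so that [f] itself need not be measurable. *)
Lemma nneg_integral_glue_le (A : set T) (f f1 f2 : T -> \bar R) :
  measurable A -> (forall x, 0 <= f x)%E ->
  (forall x, 0 <= f1 x)%E -> (forall x, 0 <= f2 x)%E ->
  (forall x, A x -> f x <= f1 x)%E -> (forall x, ~ A x -> f x <= f2 x)%E ->
  (\int[mu]_x f x <= \int[mu]_x f1 x + \int[mu]_x f2 x)%E.
Proof.
move=> mA f0 f10 f20 ff1 ff2.
rewrite ge0_integralTE//; apply: ge_ereal_sup => _ [h /= hf <-].
rewrite -integralT_nnsfun -[X in (integral _ X _ <= _)%E](setUv A).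
rewrite ge0_integral_setU//=; last 4 first.
- exact: measurableC.
- by rewrite setUv; apply/measurable_EFinP.
- by move=> x _; rewrite lee_fin.
- by rewrite disj_set2E setICr.
apply: leeD; apply: nneg_integral_part_le => // x; rewrite ?lee_fin//.
- by move=> /ff1; exact/le_trans/hf.
- by move=> /ff2; exact/le_trans/hf.
Qed.

End nneg_integral_glue.

(** * Pasting along an event *)

Definition glue (T U : Type) (A : set T) (f g : T -> U) (x : T) : U :=
  if `[< A x >] then f x else g x.

Lemma glue_in (T U : Type) (A : set T) (f g : T -> U) x :
  A x -> glue A f g x = f x.
Proof. by rewrite /glue => Ax; case: asboolP. Qed.

Lemma glue_out (T U : Type) (A : set T) (f g : T -> U) x :
  ~ A x -> glue A f g x = g x.
Proof. by rewrite /glue => Ax; case: asboolP. Qed.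

Lemma measurable_glue d d' (T : measurableType d) (U : measurableType d')
    (D A : set T) (f g : T -> U) : measurable A ->
  measurable_fun D f -> measurable_fun D g -> measurable_fun D (glue A f g).
Proof.
move=> mA mf mg mD B mB.
rewrite (_ : _ `&` _ =
    (A `&` (D `&` f @^-1` B)) `|` (~` A `&` (D `&` g @^-1` B))).
  by apply: measurableU; apply: measurableI;
    [|exact: mf|exact: measurableC|exact: mg].
apply/seteqP; split=> [x [Dx]|x [[Ax [Dx]]|[Ax [Dx]]]] /=.
- by have [Ax|Ax] := pselect (A x);
    [rewrite glue_in//; left|rewrite glue_out//; right].
- by rewrite glue_in.
- by rewrite glue_out.
Qed.

Definition glue_proc (I T U : Type) (A : set T) (f g : I -> T -> U) (s : I) :
    T -> U :=
  glue A (f s) (g s).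

(** * The augmented filtration *)

Section filtration.
Context d (Omega : measurableType d) (R : realType) (P : probability Omega R).
Context (T : R) (L : nat) (W : R -> Omega -> R) (alpha : R -> Omega -> 'I_L).

Lemma filtr_sigma_algebra t : sigma_algebra setT (filtr P W alpha t).
Proof.
split; [exact: sigma_algebra0|exact: sigma_algebraCD|exact: sigma_algebra_bigcup].
Qed.

Lemma filtr_mono s t : s <= t -> filtr P W alpha s `<=` filtr P W alpha t.
Proof.
move=> st; apply: sub_sigma_algebra2 => A [[[r [B [/andP[r0 rs] mB ->]]]|
    [r [i [/andP[r0 rs] ->]]]]|NA].
- by left; left; exists r, B; split => //; rewrite r0 (le_trans rs st).
- by left; right; exists r, i; rewrite r0 (le_trans rs st).
- by right.
Qed.

Hypothesis hP : measure_is_complete P.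
Hypothesis mW : forall t, 0 <= t <= T -> measurable_fun setT (W t).
Hypothesis malpha : forall t i, 0 <= t <= T -> measurable (alpha t @^-1` [set i]).

Lemma filtr_sub_measurable t : t <= T -> filtr P W alpha t `<=` measurable.
Proof.
move=> tT; apply: smallest_sub => [|A]; first exact: sigma_algebra_measurable.
case=> [[[s [B [/andP[s0 st] mB ->]]]|[s [i [/andP[s0 st] ->]]]]|NA].
- by rewrite -[X in measurable X]setTI; apply: mW => //; rewrite s0 (le_trans st).
- by apply: malpha; rewrite s0 (le_trans st).
- exact: hP.
Qed.

Lemma filtrW_sub_measurable t : t <= T -> filtrW P W t `<=` measurable.
Proof.
move=> tT; apply: smallest_sub => [|A]; first exact: sigma_algebra_measurable.
case=> [[s [B [/andP[s0 st] mB ->]]]|NA].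
- by rewrite -[X in measurable X]setTI; apply: mW => //; rewrite s0 (le_trans st).
- exact: hP.
Qed.

End filtration.

(** * Pasting processes and Ito integrals *)

Section glue_processes.
Context d (Omega : measurableType d) (R : realType) (P : probability Omega R).
Context (L : nat) (W : R -> Omega -> R) (alpha : R -> Omega -> 'I_L).
Notation F := (filtr P W alpha).
Context (t : R) (A : set Omega) (FA : F t A).

Lemma measurable_wrt_glue s (f g : Omega -> R) : t <= s ->
  measurable_wrt (F s) f -> measurable_wrt (F s) g ->
  measurable_wrt (F s) (glue A f g).
Proof.
move=> ts mf mg; apply: measurable_glue => //.
by apply: sub_sigma_algebra; exact: filtr_mono FA.
Qed.

Lemma prog_measurable_glue T p q (f g : R -> Omega -> 'M[R]_(p, q)) :
  prog_measurable F t T f -> prog_measurable F t T g ->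
  prog_measurable F t T (glue_proc A f g).
Proof.
move=> mf mg r /[dup] tr /andP[tler rT] i j.
rewrite [X in measurable_fun _ X](_ : _ =
  glue ((snd : measurableTypeR R * g_sigma_algebraType (F r) -> _) @^-1` A)
    (fun z => f z.1 z.2 i j) (fun z => g z.1 z.2 i j)).
  apply: measurable_glue; [|exact: mf|exact: mg].
  rewrite -[X in measurable X]setTI; apply: measurable_snd => //.
  by apply: sub_sigma_algebra; exact: filtr_mono FA.
by apply/funext => z; rewrite /glue_proc /glue/=; case: ifP.
Qed.

Hypothesis mA : measurable A.

Lemma L2_prog_glue T k (f g : R -> Omega -> 'cV[R]_k) :
  L2_prog P F t T f -> L2_prog P F t T g -> L2_prog P F t T (glue_proc A f g).
Proof.
move=> [mf f2] [mg g2]; split; first exact: prog_measurable_glue.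
have dot0 (h : R -> Omega -> 'cV[R]_k) w :
    (0 <= \int[lebesgue_measure]_(s in `[t, T]) (dotc (h s w) (h s w))%:E)%E.
  apply: integral_ge0 => s _; rewrite lee_fin sumr_ge0// => i _.
  by rewrite -expr2 sqr_ge0.
apply: le_lt_trans (lte_add_pinfty f2 g2).
apply: (nneg_integral_glue_le P mA) => // w Aw; rewrite /glue_proc;
  under eq_integral do rewrite ?(glue_in _ _ Aw) ?(glue_out _ _ Aw);
  exact: lexx.
Qed.

Definition scale_simple (B : set Omega) (H : simple_process Omega R) :
    simple_process Omega R :=
  [seq (e.1, fun w => \1_B w * e.2 w) | e <- H].

(** A term of a simple process on [t, s] has a coefficient known at the left
    end of its interval, at a time not before [t]; an event [B] of F_t is known
    by then. *)
Lemma simple_adapted_scale (B : set Omega) s H : F t B ->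
  simple_adapted P W alpha t s H ->
  simple_adapted P W alpha t s (scale_simple B H).
Proof.
move=> FB HH i; rewrite size_map => iH.
have := HH i iH; rewrite (nth_map (t, t, cst 0))//.
case: nth => [[a b] eta] /= [ta ab bs meta [M etaM]]; split => //.
- apply: measurable_funM => //; apply: measurable_indic.
  by apply: sub_sigma_algebra; exact: filtr_mono FB.
- exists M => w; rewrite normrM indicE; case: (_ \in _).
    by rewrite normr1 mul1r.
  by rewrite normr0 mul0r (le_trans _ (etaM w)).
Qed.

Lemma simple_adapted_cat s H1 H2 :
  simple_adapted P W alpha t s H1 -> simple_adapted P W alpha t s H2 ->
  simple_adapted P W alpha t s (H1 ++ H2).
Proof.
move=> a1 a2 i; rewrite size_cat nth_cat;
  case: (ltnP i (size H1)) => [iH1 _|H1i iH].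
  by have := a1 i iH1.
by have := a2 (i - size H1)%N; rewrite ltn_subLR//; apply.
Qed.

Definition glue_simple (H1 H2 : simple_process Omega R) :
    simple_process Omega R :=
  scale_simple A H1 ++ scale_simple (~` A) H2.

Lemma simple_val_glue H1 H2 r w : simple_val (glue_simple H1 H2) r w =
  glue A (simple_val H1 r) (simple_val H2 r) w.
Proof.
rewrite /simple_val big_cat !big_map/=; have [Aw|Aw] := pselect (A w).
- rewrite glue_in// [X in _ + X]big1 ?addr0.
    by apply: eq_bigr => e _; rewrite indicE mem_set// mul1r.
  by move=> e _; rewrite indicE memNset ?mul0r//; apply.
- rewrite glue_out// [X in X + _]big1 ?add0r.
    by apply: eq_bigr => e _; rewrite indicE mem_set// mul1r.
  by move=> e _; rewrite indicE memNset ?mul0r.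
Qed.

Lemma simple_integral_glue H1 H2 w : simple_integral W (glue_simple H1 H2) w =
  glue A (simple_integral W H1) (simple_integral W H2) w.
Proof.
rewrite /simple_integral big_cat !big_map/=; have [Aw|Aw] := pselect (A w).
- rewrite glue_in// [X in _ + X]big1 ?addr0.
    by apply: eq_bigr => e _; rewrite indicE mem_set// mul1r.
  by move=> e _; rewrite indicE memNset ?mul0r//; apply.
- rewrite glue_out// [X in X + _]big1 ?add0r.
    by apply: eq_bigr => e _; rewrite indicE mem_set// mul1r.
  by move=> e _; rewrite indicE memNset ?mul0r.
Qed.

Lemma cvg0_le (u a b : nat -> \bar R) : (forall k, 0 <= u k)%E ->
  (forall k, u k <= a k + b k)%E ->
  a @ \oo --> 0%E -> b @ \oo --> 0%E -> u @ \oo --> 0%E.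
Proof.
move=> u0 uab a0 b0.
apply: (@squeeze_cvge _ _ _ _ (cst 0%E) _ (fun k => a k + b k)%E).
- by apply: nearW => k; rewrite u0 uab.
- exact: cvg_cst.
- by rewrite -[X in _ --> X]adde0; apply: cvgeD.
Qed.

(** Pasted simple processes approximate the pasted integrand, and their
    integrals the pasted integral, because on each of the two pieces the squared
    error is that of one of the two given approximations. *)
Lemma is_ito_integral_glue s phi1 phi2 I1 I2 : t <= s ->
  is_ito_integral P W alpha t s phi1 I1 ->
  is_ito_integral P W alpha t s phi2 I2 ->
  is_ito_integral P W alpha t s (glue_proc A phi1 phi2) (glue A I1 I2).
Proof.
move=> ts [mI1 I1oo [H1 [aH1 H1phi H1I]]] [mI2 I2oo [H2 [aH2 H2phi H2I]]].
have sq0 (f : Omega -> R) w : (0 <= ((f w) ^+ 2)%:E)%E by rewrite lee_fin sqr_ge0.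
split.
- exact: measurable_wrt_glue.
- apply: le_lt_trans (lte_add_pinfty I1oo I2oo).
  apply: (nneg_integral_glue_le P mA) => // w Aw;
  by rewrite ?(glue_in _ _ Aw) ?(glue_out _ _ Aw).
- exists (fun k => glue_simple (H1 k) (H2 k)); split.
  + move=> k; apply: simple_adapted_cat; apply: simple_adapted_scale => //.
    by rewrite -setTD; case: (filtr_sigma_algebra P W alpha t) => _ FC _;
      exact: FC.
  + apply: cvg0_le H1phi H2phi => k.
      apply: integral_ge0 => w _; apply: integral_ge0 => r _.
      by rewrite lee_fin sqr_ge0.
    apply: (nneg_integral_glue_le P mA) => [w|w|w|w Aw|w Aw];
      try by apply: integral_ge0 => r _; rewrite lee_fin sqr_ge0.
    * rewrite le_eqVlt; apply/orP; left; apply/eqP/eq_integral => r _.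
      by rewrite simple_val_glue /glue_proc !glue_in.
    * rewrite le_eqVlt; apply/orP; left; apply/eqP/eq_integral => r _.
      by rewrite simple_val_glue /glue_proc !glue_out.
  + apply: cvg0_le H1I H2I => k.
      by apply: integral_ge0 => w _; rewrite lee_fin sqr_ge0.
    apply: (nneg_integral_glue_le P mA) => w; rewrite ?lee_fin ?sqr_ge0//= => Aw;
    by rewrite simple_integral_glue ?(glue_in _ _ Aw) ?(glue_out _ _ Aw).
Qed.

End glue_processes.

(** * Pasting states and costs *)

Section glue_state.
Context d (Omega : measurableType d) (R : realType) (P : probability Omega R).
Context (n m L : nat) (T : R).
Variables (W : R -> Omega -> R) (alpha : R -> Omega -> 'I_L).
Variable K : lq_data R Omega n m L.
Context (t : R) (xi : Omega -> 'cV[R]_n) (vartheta : Omega -> 'I_L).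
Variables (u1 u2 : R -> Omega -> 'cV[R]_m) (X1 X2 : R -> Omega -> 'cV[R]_n).
Context (A : set Omega).

Lemma diffusion_glue :
  diffusion alpha K (glue_proc A u1 u2) (glue_proc A X1 X2) =
  glue_proc A (diffusion alpha K u1 X1) (diffusion alpha K u2 X2).
Proof.
apply/funext => s; apply/funext => w; rewrite /diffusion /glue_proc /glue.
by case: ifP.
Qed.

Lemma drift_glue :
  drift alpha K (glue_proc A u1 u2) (glue_proc A X1 X2) =
  glue_proc A (drift alpha K u1 X1) (drift alpha K u2 X2).
Proof.
apply/funext => s; apply/funext => w; rewrite /drift /glue_proc /glue.
by case: ifP.
Qed.

(** Every term of the state equation except the Ito integral is computed path
    by path, so it is pasted pointwise. *)
Lemma is_state_glue : filtr P W alpha t A -> measurable A ->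
  is_state P T W alpha K t xi vartheta u1 X1 ->
  is_state P T W alpha K t xi vartheta u2 X2 ->
  is_state P T W alpha K t xi vartheta (glue_proc A u1 u2) (glue_proc A X1 X2).
Proof.
move=> FA mA [X1L X1c X1v X1e] [X2L X2c X2v X2e]; split.
- exact: L2_prog_glue.
- apply: filterS2 X1c X2c => w c1 c2; have [Aw|Aw] := pselect (A w).
    have -> : (fun s => glue_proc A X1 X2 s w) = (fun s => X1 s w);
      last exact: c1.
    by apply/funext => s; rewrite /glue_proc glue_in.
  have -> : (fun s => glue_proc A X1 X2 s w) = (fun s => X2 s w);
    last exact: c2.
  by apply/funext => s; rewrite /glue_proc glue_out.
- exact: X1v.
- move=> s /[dup] /andP[ts _] tsT.
  have [I1 ito1 eq1] := X1e s tsT; have [I2 ito2 eq2] := X2e s tsT.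
  exists (glue A I1 I2).
    move=> i; rewrite diffusion_glue.
    have := is_ito_integral_glue FA mA ts (ito1 i) (ito2 i).
    congr (is_ito_integral _ _ _ _ _ _ _); apply/funext => r.
      by apply/funext => w; rewrite /glue_proc /glue; case: ifP.
    by rewrite /glue; case: ifP.
  apply: filterS2 eq1 eq2 => w e1 e2; rewrite drift_glue /glue_proc.
  have [Aw|Aw] := pselect (A w).
    rewrite !glue_in// e1; congr (_ + _ + _); apply/matrixP => i j; rewrite !mxE.
    by apply: eq_Rintegral => r _; rewrite glue_in.
  rewrite !glue_out// e2; congr (_ + _ + _); apply/matrixP => i j; rewrite !mxE.
  by apply: eq_Rintegral => r _; rewrite glue_out.
Qed.

Lemma pathwise_cost_glue :
  pathwise_cost T alpha K t (glue_proc A u1 u2) (glue_proc A X1 X2) =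
  glue A (pathwise_cost T alpha K t u1 X1) (pathwise_cost T alpha K t u2 X2).
Proof.
apply/funext => w; rewrite /pathwise_cost /running_cost /glue_proc.
by rewrite /glue; case: asboolP.
Qed.

End glue_state.

(** * Comparing conditional and unconditional expectations *)

Section compare_cond_exp.
Context d (Omega : measurableType d) (R : realType) (P : probability Omega R).
Context (G : set (set Omega)) (sG : sigma_algebra setT G).
Context (GM : G `<=` measurable).
Variables (c1 c2 Y1 Y2 : Omega -> R).
Hypothesis Ic1 : P.-integrable setT (EFin \o c1).
Hypothesis Ic2 : P.-integrable setT (EFin \o c2).
Hypothesis HY1 : is_cond_exp P G c1 Y1.
Hypothesis HY2 : is_cond_exp P G c2 Y2.

Lemma cond_exp_lt_set : G [set w | Y2 w < Y1 w].
Proof.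
have [mY1 _ _] := HY1; have [mY2 _ _] := HY2.
have mlt : measurable ([set w | Y2 w < Y1 w] : set (g_sigma_algebraType G)).
  rewrite -[X in measurable X]setTI.
  by have /(_ measurableT [set true]) := measurable_fun_ltr mY2 mY1; apply.
by move: mlt; rewrite measurable_g_measurableTypeE.
Qed.

Lemma ae_le_cond_exp_expectation : {ae P, forall w, Y1 w <= Y2 w} ->
  ('E_P[c1] <= 'E_P[c2])%E.
Proof.
have [mY1 IY1 EY1] := HY1; have [mY2 IY2 EY2] := HY2 => le12.
have GT : G setT by have [G0 /(_ set0 G0)] := sG; rewrite setD0.
rewrite unlock -(EY1 _ GT) -(EY2 _ GT).
have ID := integrableB measurableT IY2 IY1.
rewrite -sube_ge0; last by rewrite integrable_fin_num.
rewrite -integralB_EFin// (ae_eq_integral (fun w => `|(Y2 w - Y1 w)%:E|%E))//=.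
- by apply: integral_ge0 => w _; rewrite lee_fin.
- exact: measurable_int ID.
- exact: measurable_int (integrable_abse ID).
- by apply: filterS le12 => w le12 _; rewrite ger0_norm// subr_ge0.
Qed.

(** Off the set [A] where [Y2 < Y1] the pasted cost is [c1], so the hypothesis
    only compares the integrals over [A]; there [Y1 - Y2] is positive with
    nonpositive integral, which forces [A] to be negligible. *)
Lemma glue_expectation_le_cond_exp_ae :
  ('E_P[c1] <= 'E_P[glue [set w | (Y2 w < Y1 w)%R] c2 c1])%E ->
  {ae P, forall w, Y1 w <= Y2 w}.
Proof.
have [mY1 IY1 EY1] := HY1; have [mY2 IY2 EY2] := HY2.
have GA := cond_exp_lt_set; set A := [set w | _] in GA *.
have mA : measurable A by exact: GM.
have mCA : measurable (~` A) by exact: measurableC.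
have mc1 : measurable_fun setT c1.
  by apply/measurable_EFinP; exact: measurable_int Ic1.
have mc2 : measurable_fun setT c2.
  by apply/measurable_EFinP; exact: measurable_int Ic2.
have mg : measurable_fun setT (glue A c2 c1) by exact: measurable_glue.
have split_A (f : Omega -> R) : measurable_fun setT f ->
    (\int[P]_w (f w)%:E =
     \int[P]_(w in A) (f w)%:E + \int[P]_(w in ~` A) (f w)%:E)%E.
  move=> mf; rewrite -integral_setU ?setUv//; last by rewrite disj_set2E setICr.
  exact/measurable_EFinP.
have on_A (f : Omega -> R) B : measurable B -> P.-integrable setT (EFin \o f) ->
    P.-integrable B (EFin \o f) by move=> mB; exact: integrableS.
rewrite unlock (split_A _ mc1) (split_A _ mg).
rewrite [X in (_ <= X + _)%E](eq_integral (EFin \o c2)); last first.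
  by move=> w /set_mem Aw /=; rewrite glue_in.
rewrite [X in (_ <= _ + X)%E](eq_integral (EFin \o c1)); last first.
  by move=> w /set_mem Aw /=; rewrite glue_out.
rewrite leeD2rE; last by apply: integrable_fin_num => //; exact: on_A.
rewrite -EY1// -EY2// -sube_le0 => D_le0.
have IA1 := on_A _ _ mA IY1; have IA2 := on_A _ _ mA IY2.
have ID := integrableB mA IA1 IA2.
have D0 : (\int[P]_(w in A) `|(Y1 w - Y2 w)%:E| = 0)%E.
  apply/eqP; rewrite eq_le integral_ge0// andbT.
  rewrite (eq_integral (fun w => (Y1 w - Y2 w)%:E)).
    by rewrite integralB_EFin.
  by move=> w /set_mem /= Aw; rewrite ger0_norm// subr_ge0 ltW.
have /ae_eq_integral_abs : measurable_fun A (fun w => (Y1 w - Y2 w)%:E).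
  exact: measurable_int ID.
move=> /(_ P mA) [/(_ D0) ae0 _].
apply: filterS ae0 => w /= D0w; rewrite leNgt; apply/negP => /[dup] Aw /D0w [].
by apply/eqP; rewrite subr_eq0 gt_eqF.
Qed.

End compare_cond_exp.

(** * Square-integrable functions *)

Section square_integrable.
Context d (T : measurableType d) (R : realType) (mu : {measure set T -> \bar R}).
Context (D : set T) (mD : measurable D).
Implicit Types f g b : T -> R.

Definition sq_integrable f : Prop :=
  measurable_fun D f /\ mu.-integrable D (EFin \o (fun x => f x ^+ 2)).

Lemma sq_integrable_lty f : measurable_fun D f ->
  (\int[mu]_(x in D) ((f x) ^+ 2)%:E < +oo)%E -> sq_integrable f.
Proof.
move=> mf foo; split=> //; apply/integrableP; split.
  by apply/measurable_EFinP; exact: measurable_funX.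
rewrite (le_lt_trans _ foo)// le_eqVlt; apply/orP; left; apply/eqP.
by apply: eq_integral => x _ /=; rewrite ger0_norm ?sqr_ge0.
Qed.

Lemma sq_integrable_dominated f g (C : R) : measurable_fun D f ->
  (forall x, D x -> `|f x| <= C * `|g x|) -> sq_integrable g ->
  sq_integrable f.
Proof.
move=> mf fg [mg g2]; split=> //.
apply: le_integrable (integrableZl mD (C ^+ 2) g2) => //.
  by apply/measurable_EFinP; exact: measurable_funX.
move=> x Dx /=; rewrite lee_fin -exprMn !normrX normrM.
rewrite ler_sqr ?nnegrE ?mulr_ge0//.
by rewrite (le_trans (fg x Dx))// ler_wpM2r// ler_norm.
Qed.

Lemma sq_integrableM f g : sq_integrable f -> sq_integrable g ->
  mu.-integrable D (EFin \o (fun x => f x * g x)).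
Proof.
move=> [mf f2] [mg g2].
apply: le_integrable (integrableD mD f2 g2) => //.
  by apply/measurable_EFinP; exact: measurable_funM.
move=> x Dx /=; rewrite lee_fin [leRHS]ger0_norm ?addr_ge0 ?sqr_ge0//.
rewrite ler_norml; apply/andP; split; rewrite -subr_ge0.
  suff : 0 <= (f x + g x) ^+ 2 + f x ^+ 2 + g x ^+ 2 by nra.
  by rewrite !addr_ge0 ?sqr_ge0.
suff : 0 <= (f x - g x) ^+ 2 + f x ^+ 2 + g x ^+ 2 by nra.
by rewrite !addr_ge0 ?sqr_ge0.
Qed.

Lemma sq_integrableD f g : sq_integrable f -> sq_integrable g ->
  sq_integrable (fun x => f x + g x).
Proof.
move=> If Ig; have [[mf f2] [mg g2]] := (If, Ig); split.
  exact: measurable_funD.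
have fg := integrableZl mD 2 (sq_integrableM If Ig).
have := integrableD mD (integrableD mD f2 g2) fg.
by congr (mu.-integrable D _); apply/funext => x /=; rewrite -EFinM -!EFinD;
  congr EFin; ring.
Qed.

Lemma sq_integrable0 : sq_integrable (cst 0).
Proof.
split; first exact: measurable_cst.
rewrite (_ : _ \o _ = cst 0%E); first exact: integrable0.
by apply/funext => x /=; rewrite expr0n.
Qed.

Lemma sq_integrable_sum (I : Type) (s : seq I) (f : I -> T -> R) :
  (forall i, sq_integrable (f i)) -> sq_integrable (fun x => \sum_(i <- s) f i x).
Proof.
move=> If; elim: s => [|i s IH].
  by under eq_fun do rewrite big_nil; exact: sq_integrable0.
by under eq_fun do rewrite big_cons; exact: sq_integrableD.
Qed.

Lemma sq_integrable_bounded b f (C : R) : measurable_fun D b ->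
  (forall x, D x -> `|b x| <= C) -> sq_integrable f ->
  sq_integrable (fun x => b x * f x).
Proof.
move=> mb bC If; apply: (sq_integrable_dominated (C := C) _ _ If).
  by apply: measurable_funM => //; case: If.
by move=> x Dx; rewrite normrM ler_wpM2r// bC.
Qed.

(** Cauchy-Schwarz against the constant 1: with [c] the integral of [f],
    integrate [2 * r * f <= r ^+ 2 + f ^+ 2] and choose the optimal [r]. *)
Lemma sqr_Rintegral_le f (l : R) : 0 < l -> (mu D <= l%:E)%E ->
  mu.-integrable D (EFin \o f) ->
  mu.-integrable D (EFin \o (fun x => f x ^+ 2)) ->
  (\int[mu]_(x in D) f x) ^+ 2 <= l * \int[mu]_(x in D) (f x ^+ 2).
Proof.
move=> l0 Dl If If2; set c := (X in X ^+ 2 <= _); set S := (X in _ <= _ * X).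
have Doo : (mu D < +oo)%E by rewrite (le_lt_trans Dl)// ltry.
have Icst r : mu.-integrable D (EFin \o cst r).
  apply/integrableP; split; first exact/measurable_EFinP.
  by rewrite (eq_integral (cst (`|r|%:E)%E))// integral_cst//= lte_mul_pinfty.
have mDl : fine (mu D) <= l.
  by rewrite -lee_fin fineK// ge0_fin_numE.
have mD0 : 0 <= fine (mu D) by rewrite fine_ge0.
have amgm r : 2 * r * c <= r ^+ 2 * fine (mu D) + S.
  rewrite -Rintegral_cst// /S /c -RintegralZl// -RintegralD//; last exact: Icst.
  apply: le_Rintegral => //.
  - exact: (integrableZl mD (2 * r) If).
  - exact: (integrableD mD (Icst (r ^+ 2)) If2).
  - move=> x Dx; have := sqr_ge0 (r - f x); nra.
(* When the measure of [D] is [l], the bound is sharpest at [r = c / l]. *)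
have := amgm (c / l).
have -> : 2 * (c / l) * c = 2 * (c ^+ 2 / l) by ring.
move=> h; have : c ^+ 2 / l <= S.
  have : (c / l) ^+ 2 * fine (mu D) <= (c / l) ^+ 2 * l.
    by rewrite ler_wpM2l ?sqr_ge0.
  have -> : (c / l) ^+ 2 * l = c ^+ 2 / l by field; rewrite gt_eqF.
  lra.
by rewrite ler_pdivrMr// mulrC.
Qed.

End square_integrable.

(** * Integration in time over a strip *)

(** The time coordinate comes second so that a function is integrated in time
    first by the iterated integrals over [P \x lebesgue_measure]. *)
Definition strip d (Omega : measurableType d) (R : realType) (t T : R) :
    set (Omega * measurableTypeR R) :=
  setT `*` `[t, T].
Arguments strip {d} Omega {R} t T.

Lemma measurable_strip d (Omega : measurableType d) (R : realType) (t T : R) :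
  measurable (strip Omega t T).
Proof. by apply: measurableX. Qed.
Arguments measurable_strip {d} Omega {R} t T.

Section time_integral.
Context d (Omega : measurableType d) (R : realType) (P : probability Omega R).
Context (t T : R).

Notation lam := (@lebesgue_measure R).
Notation PxT := (P \x lam)%E.
Notation strip := (strip Omega t T).
Let mstrip : measurable strip := measurable_strip Omega t T.
Implicit Types F : Omega * measurableTypeR R -> R.

Let restrict_strip F w s :
  ((EFin \o F) \_ strip) (w, s) = ((fun s => (F (w, s))%:E) \_ `[t, T]) s.
Proof.
rewrite !patchE; congr (if _ then _ else _).
by apply/idP/idP; rewrite !inE /strip/=; [case|].
Qed.

Lemma sq_integrable_strip F : measurable_fun strip F ->
  (\int[P]_w \int[lam]_(s in `[t, T]) ((F (w, s)) ^+ 2)%:E < +oo)%E ->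
  sq_integrable PxT strip F.
Proof.
move=> mF Foo; split=> //; apply/integrable_mkcond; first exact: mstrip.
have mF2 : measurable_fun setT ((EFin \o (fun z => F z ^+ 2)) \_ strip).
  have mF1 : measurable_fun strip (EFin \o (fun z => F z ^+ 2)).
    by apply/measurable_EFinP; exact: measurable_funX.
  exact: (measurable_restrictT _ mstrip).1 mF1.
apply/integrable12ltyP => //; rewrite (le_lt_trans _ Foo)// le_eqVlt.
apply/orP; left; apply/eqP/eq_integral => w _.
rewrite [RHS]integral_mkcond; apply: eq_integral => s _.
rewrite restrict_strip patchE; case: ifP => _ //=; last by rewrite normr0.
by rewrite ger0_norm ?sqr_ge0.
Qed.

Lemma integrable_time_integral F : PxT.-integrable strip (EFin \o F) ->
  P.-integrable setT
    (EFin \o (fun w => \int[lam]_(s in `[t, T]) F (w, s))).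
Proof.
move=> /(integrable_mkcond _ mstrip) IF.
have IG := integrable_fubini_F IF.
have GE w : fubini_F lam ((EFin \o F) \_ strip) w =
    (\int[lam]_(s in `[t, T]) (F (w, s))%:E)%E.
  by rewrite /fubini_F [RHS]integral_mkcond; apply: eq_integral => s _;
    rewrite restrict_strip.
apply: le_integrable IG => //.
  apply/measurable_EFinP; rewrite /Rintegral.
  apply: (measurableT_comp (f := fine)) => //.
  by under eq_fun do rewrite -GE; exact: measurable_fubini_F IF.
move=> w _ /=; rewrite GE /Rintegral.
by move: (integral _ _ _) => [r| |] /=; rewrite ?normr0 ?lexx ?leey.
Qed.

Lemma ae_integrable_section F : PxT.-integrable strip (EFin \o F) ->
  {ae P, forall w, lam.-integrable `[t, T] (fun s => (F (w, s))%:E)}.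
Proof.
move=> /(integrable_mkcond _ mstrip) /ae_integrable1.
apply: filterS => w Iw; apply/integrable_mkcond => //.
by move: Iw; under eq_fun do rewrite restrict_strip.
Qed.

(** The strip has finite measure, so the constant 1 is square integrable. *)
Lemma sq_integrable_integrable F : sq_integrable PxT strip F ->
  PxT.-integrable strip (EFin \o F).
Proof.
move=> IF.
have I1 : sq_integrable PxT strip (cst 1).
  apply: sq_integrable_strip; first exact: measurable_cst.
  under eq_integral do rewrite /= expr1n.
  under eq_integral do
    rewrite (integral_cst _ _ 1%E)//= mul1e lebesgue_measure_itv.
  rewrite (integral_cst _ _ (if _ then _ else _))//= probability_setT mule1.
  by case: ifP => // _; rewrite ltry.
have := sq_integrableM mstrip I1 IF.
by congr (PxT.-integrable _ _); apply/funext => z /=; rewrite mul1r.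
Qed.

Lemma sq_integrable_time_integral F : sq_integrable PxT strip F ->
  sq_integrable P setT (fun w => \int[lam]_(s in `[t, T]) F (w, s)).
Proof.
move=> IF; have IF1 := sq_integrable_integrable IF.
have IS := integrable_time_integral IF1.
have mS : measurable_fun setT (fun w => \int[lam]_(s in `[t, T]) F (w, s)).
  by apply/measurable_EFinP; exact: measurable_int IS.
have [_ IF2] := IF; have IS2 := integrable_time_integral IF2.
split=> //.
(* A positive bound on the length of the interval, even when [t = T]. *)
pose l : R := `|T - t| + 1.
have l0 : 0 < l by rewrite ltr_wpDl.
have Dl : (lam `[t, T]%classic <= l%:E)%E.
  rewrite lebesgue_measure_itv/= lte_fin.
  case: ifP => _; last by rewrite lee_fin ltW.
  by rewrite -EFinD lee_fin /l; have := ler_norm (T - t); lra.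
apply/integrableP; split.
  by apply/measurable_EFinP; exact: measurable_funX.
have [mZ] := integrableP _ _ _ (integrableZl measurableT l IS2).
apply: le_lt_trans; apply: ae_ge0_le_integral => //.
- apply: measurableT_comp => //; apply/measurable_EFinP; exact: measurable_funX.
- exact: measurableT_comp.
apply: filterS2 (ae_integrable_section IF1) (ae_integrable_section IF2).
move=> w I1 I2 _ /=.
rewrite lee_fin ger0_norm ?sqr_ge0// (le_trans _ (ler_norm _))//.
exact: sqr_Rintegral_le.
Qed.

End time_integral.

(** * Square-integrable vectors and bounded matrices *)

Lemma measurable_fun_select d d' (T : measurableType d) (U : measurableType d')
    (I : finType) (D : set T) (a : T -> I) (f : I -> T -> U) :
  (forall i, measurable (D `&` a @^-1` [set i])) ->
  (forall i, measurable_fun D (f i)) -> measurable_fun D (fun x => f (a x) x).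
Proof.
move=> ma mf mD B mB.
rewrite (_ : _ `&` _ = \bigcup_(i in [set: I])
    ((D `&` a @^-1` [set i]) `&` (D `&` f i @^-1` B))).
  apply: fin_bigcup_measurable => [|i _]; first exact: finite_finset.
  by apply: measurableI; [exact: ma|exact: mf].
apply/seteqP; split => [x [Dx Bx]|x [i _ [[Dx <-] [_ Bx]]]//].
by exists (a x).
Qed.

Section bounded_matrices.
Context d (T : measurableType d) (R : realType) (mu : {measure set T -> \bar R}).
Context (D : set T) (mD : measurable D).

Definition bounded_mx p q (M : T -> 'M[R]_(p, q)) : Prop :=
  (forall i j, measurable_fun D (fun x => M x i j)) /\
  exists C, forall x i j, D x -> `|M x i j| <= C.

Definition sq_integrable_cV p (V : T -> 'cV[R]_p) : Prop :=
  forall i, sq_integrable mu D (fun x => V x i 0).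

Lemma sq_integrable_mulmx p q (M : T -> 'M[R]_(p, q)) V :
  bounded_mx M -> sq_integrable_cV V -> sq_integrable_cV (fun x => M x *m V x).
Proof.
move=> [mM [C MC]] IV i; under eq_fun do rewrite mxE.
apply: sq_integrable_sum => // k.
by apply: (sq_integrable_bounded mD (mM i k) _ (IV k)) => x Dx; exact: MC.
Qed.

Lemma sq_integrable_addmx p (V V' : T -> 'cV[R]_p) :
  sq_integrable_cV V -> sq_integrable_cV V' ->
  sq_integrable_cV (fun x => V x + V' x).
Proof.
by move=> IV IV' i; under eq_fun do rewrite mxE; exact: sq_integrableD.
Qed.

Lemma integrable_dotc p (V V' : T -> 'cV[R]_p) :
  sq_integrable_cV V -> sq_integrable_cV V' ->
  mu.-integrable D (EFin \o (fun x => dotc (V x) (V' x))).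
Proof.
move=> IV IV'; have := @integrable_sum _ _ _ mu D mD _ (index_enum 'I_p) predT
  (fun i => EFin \o (fun x => V x i 0 * V' x i 0)).
move=> /(_ (fun i _ => sq_integrableM mD (IV i) (IV' i))).
by congr (mu.-integrable _ _); apply/funext => x /=; rewrite sumEFin.
Qed.

Lemma bounded_mx_select (I : finType) p q (a : T -> I)
    (M : I -> T -> 'M[R]_(p, q)) :
  (forall i, measurable (D `&` a @^-1` [set i])) ->
  (forall i, bounded_mx (M i)) -> bounded_mx (fun x => M (a x) x).
Proof.
move=> ma bM; split.
  move=> i j; apply: (measurable_fun_select (f := fun k x => M k x i j)) => // k.
  by have [] := bM k.
have /choice[C MC] k : exists C, forall x i j, D x -> `|M k x i j| <= C.
  by have [] := bM k.
exists (\sum_k `|C k|) => x i j Dx; apply: le_trans (MC _ _ _ _ Dx) _.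
by rewrite (bigD1 (a x))//= (le_trans (ler_norm _))// lerDl sumr_ge0.
Qed.

Lemma sqr_coord_le_dotc p (v : 'cV[R]_p) i : v i 0 ^+ 2 <= dotc v v.
Proof.
rewrite /dotc (bigD1 i)//= -expr2 lerDl sumr_ge0// => k _.
by rewrite -expr2 sqr_ge0.
Qed.

End bounded_matrices.

Lemma ae_eq_sq_integrable d (T : measurableType d) (R : realType)
    (mu : {measure set T -> \bar R}) (f g : T -> R) :
  measurable_fun setT f -> {ae mu, forall x, f x = g x} ->
  sq_integrable mu setT g -> sq_integrable mu setT f.
Proof.
move=> mf fg [mg g2]; split=> //.
have mf2 : measurable_fun setT (fun x => (f x ^+ 2)%:E).
  by apply/measurable_EFinP; exact: measurable_funX.
apply/integrableP; split=> //; have [_] := integrableP _ _ _ g2.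
apply: le_lt_trans; apply: ae_ge0_le_integral => //.
- exact: measurableT_comp.
- apply: measurableT_comp => //; exact: measurable_int g2.
- by apply: filterS fg => x /= -> _.
Qed.

(** * Joint measurability in time and randomness *)

Section strip_measurability.
Context d (Omega : measurableType d) (R : realType) (T : R).

Lemma prog_measurable_strip (F : R -> set (set Omega)) t0 t p q
    (phi : R -> Omega -> 'M[R]_(p, q)) i j :
  t0 <= t -> t <= T -> F T `<=` measurable -> prog_measurable F t0 T phi ->
  measurable_fun (strip Omega t T) (fun z => phi z.2 z.1 i j).
Proof.
move=> t0t tT FM mphi.
have := mphi T; rewrite (le_trans t0t tT) lexx => /(_ isT i j) mT.
pose sw (z : Omega * measurableTypeR R) :
  measurableTypeR R * g_sigma_algebraType (F T) := (z.2, z.1).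
apply: (measurable_comp (F := `[t0, T] `*` setT) (g := sw) _ _ mT).
- exact: measurableX.
- move=> z [[w s] [_ st] <-]; move: st; rewrite /= in_itv/= => /andP[ts sT].
  by split => //=; rewrite in_itv/= sT (le_trans t0t ts).
apply: measurable_funTS; apply: measurable_fun_pair; first exact: measurable_snd.
exact: measurableT_comp (measurable_idfun_sub FM) measurable_fst.
Qed.

Lemma prog_measurable_section (F : R -> set (set Omega)) t0 p q
    (phi : R -> Omega -> 'M[R]_(p, q)) i j :
  t0 <= T -> F T `<=` measurable -> prog_measurable F t0 T phi ->
  measurable_fun setT (fun w => phi T w i j).
Proof.
move=> tT FM /(prog_measurable_strip i j tT (lexx T) FM) mT.
apply: (measurable_comp
  (f := fun z : Omega * measurableTypeR R => phi z.2 z.1 i j)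
  (F := strip Omega T T) (g := fun w => (w, T)) _ _ mT).
- exact: measurable_strip.
- by move=> z [w _ <-]; split => //=; rewrite in_itv/= lexx.
- exact: measurable_fun_pair.
Qed.

(** Round the time up to the next multiple of 1/(n + 1), capped at the horizon.
    For fixed n the rounded chain is constant in time on each cell of the grid,
    so the times and outcomes at which it is in state [i] form a countable union
    of measurable rectangles.  Rounding strictly upwards makes right-continuity
    apply: the rounded chain eventually agrees with the chain as n grows. *)
Lemma measurable_strip_right_continuous (L : nat) (alpha : R -> Omega -> 'I_L) :
  0 < T ->
  (forall (s : R) i, 0 <= s <= T -> measurable (alpha s @^-1` [set i])) ->
  (forall w (s : R), 0 <= s < T -> \forall r \near s^'+, alpha r w = alpha s w) ->
  forall i,
    measurable (strip Omega 0 T `&` (fun z => alpha z.2 z.1) @^-1` [set i]).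
Proof.
move=> T0 ma rc i.
pose kap k n : R := Num.min T (k.+1%:R / n.+1%:R).
have kap0 k n : 0 <= kap k n <= T.
  by rewrite /kap ge_min lexx /= andbT le_min (ltW T0) /= divr_ge0.
pose E n := \bigcup_k ((alpha (kap k n) @^-1` [set i]) `*`
   [set s : measurableTypeR R | k%:R / n.+1%:R <= s < k.+1%:R / n.+1%:R]).
have mE n : measurable (E n).
  apply: bigcup_measurable => k _; apply: measurableX; first exact: ma.
  rewrite (_ : [set _ | _] = `[k%:R / n.+1%:R, k.+1%:R / n.+1%:R[%classic).
    exact: measurable_itv.
  by apply/seteqP; split => s /=; rewrite in_itv.
rewrite (_ : _ `&` _ = strip Omega 0 T `&`
    \bigcup_N \bigcap_(n in [set n | (N <= n)%N]) E n).
  apply: measurableI; first exact: measurable_strip.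
  apply: bigcup_measurable => N _; apply: bigcap_measurableType => n _; exact: mE.
pose r (n : nat) (s : R) : R := (Num.truncn (s * n.+1%:R)).+1%:R / n.+1%:R.
have EP n w (s : R) : 0 <= s -> E n (w, s) <-> alpha (Num.min T (r n s)) w = i.
  move=> s0; split=> [[k _ [/= <- /andP[ks sk]]]|ari].
    rewrite /r (@truncn_def _ _ k)//.
    by rewrite -ler_pdivrMr// -ltr_pdivlMr// ks.
  exists (Num.truncn (s * n.+1%:R)) => //; split => //=.
  by rewrite ler_pdivrMr// ltr_pdivlMr// truncn_itv// mulr_ge0.
have r_gt n (s : R) : 0 <= s -> s < r n s <= s + n.+1%:R^-1.
  move=> s0; have /andP[le1 lt1] := truncn_itv (mulr_ge0 s0 (ler0n R n.+1)).
  rewrite /r ltr_pdivlMr// lt1 ler_pdivrMr// mulrDl mulVf ?pnatr_eq0//.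
  by rewrite -natr1 lerD2r.
have ev w (s : R) : 0 <= s <= T -> exists N, forall n, (N <= n)%N ->
    alpha (Num.min T (r n s)) w = alpha s w.
  move=> /andP[s0 sT]; have [sltT|] := ltP s T; last first.
    move=> Ts; exists 0%N => n _; have /eqP sE : s == T by rewrite eq_le sT.
    have /andP[sr _] := r_gt n s s0.
    by rewrite -sE min_l// ltW.
  have sT' : 0 <= s < T by rewrite s0.
  have [e /= e0 He] := rc w s sT'.
  exists (Num.truncn e^-1) => n Nn.
  have /andP[sr rs] := r_gt n s s0.
  have ms : s < Num.min T (r n s) by rewrite lt_min sltT.
  apply: He => //=; rewrite ltr0_norm ?subr_lt0// opprB ltrBlDl.
  rewrite gt_min (le_lt_trans rs) ?orbT// ltrD2l invf_plt ?posrE//.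
  have ie0 : 0 <= e^-1 by rewrite invr_ge0 ltW.
  have /andP[_ lt1] := truncn_itv ie0.
  by rewrite (lt_le_trans lt1)// ler_nat.
apply/seteqP; split => [[w s] [[_ /=]]|[w s] [[_ /=]]]; rewrite in_itv/= => s0T.
- have /andP[s0 sT] := s0T.
  move=> asi; split; first by split => //=; rewrite in_itv.
  have [N HN] := ev w s s0T; exists N => // n /= Nn.
  by apply/EP => //; rewrite HN.
- have /andP[s0 sT] := s0T.
  move=> [N _ HN]; split; first by split => //=; rewrite in_itv.
  have [N' HN'] := ev w s s0T.
  have /EP := HN (maxn N N') (leq_maxl _ _).
  by rewrite HN' ?leq_maxr//; apply.
Qed.

End strip_measurability.

(** * Integrability of the cost *)

Section cost_integrability.
Context (R : realType) (d : measure_display) (Omega : measurableType d).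
Context (P : probability Omega R) (hP : measure_is_complete P).
Context (T : R) (hT : 0 < T) (n m L : nat).
Context (W : R -> Omega -> R) (hW : brownian_motion P T W).
Context (lambda : R -> 'M[R]_L) (alpha : R -> Omega -> 'I_L).
Context (halpha : markov_chain P T alpha lambda).
Context (K : lq_data R Omega n m L) (hK : lq_assumptions P T W K).
Context (t : R) (xi : Omega -> 'cV[R]_n) (vartheta : Omega -> 'I_L).
Context (hD : initial_triple P T W alpha t xi vartheta).

Notation lam := (@lebesgue_measure R).
Notation PxT := (P \x lam)%E.
Notation F := (filtr P W alpha).

Let t0T : 0 <= t <= T. Proof. by case: hD. Qed.
Let t0 : 0 <= t. Proof. by case/andP: t0T. Qed.
Let tT : t <= T. Proof. by case/andP: t0T. Qed.

Lemma filtr_measurable s : s <= T -> F s `<=` measurable.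
Proof.
exact: (filtr_sub_measurable hP (bm_measurable hW) (mc_measurable halpha)).
Qed.

Lemma filtrW_measurable s : s <= T -> filtrW P W s `<=` measurable.
Proof. exact: (filtrW_sub_measurable hP (bm_measurable hW)). Qed.

Lemma measurable_chain_strip i :
  measurable (strip Omega t T `&` (fun z => alpha z.2 z.1) @^-1` [set i]).
Proof.
have mi := measurable_strip_right_continuous hT (mc_measurable halpha)
  (mc_right_continuous halpha) i.
rewrite (_ : _ `&` _ = strip Omega t T `&` (strip Omega 0 T `&`
    (fun z => alpha z.2 z.1) @^-1` [set i])).
  by apply: measurableI => //; exact: measurable_strip.
apply/seteqP; split=> [z [Sz az]|z [Sz [_ az]]] //.
split=> //; split=> //; move: Sz => [_ /=]; rewrite in_itv/= => /andP[tz zT].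
by split => //=; rewrite in_itv/= zT (le_trans t0 tz).
Qed.

Lemma bounded_coef_strip p q (phi : R -> 'I_L -> Omega -> 'M[R]_(p, q)) :
  (forall i, admissible_coef P T W (fun s => phi s i)) ->
  bounded_mx (strip Omega t T) (fun z => phi z.2 (alpha z.2 z.1) z.1).
Proof.
move=> aphi.
apply: (bounded_mx_select (a := fun z => alpha z.2 z.1)
  (M := fun i z => phi z.2 i z.1)) => [|i].
  exact: measurable_chain_strip.
have [[C HC] mphi] := aphi i; split.
  move=> j k.
  apply: (prog_measurable_strip (phi := fun s => phi s i) _ _ t0 tT _ mphi).
  exact: filtrW_measurable.
exists C => -[w s] j k [_ /=]; rewrite in_itv/= => /andP[ts sT].
by apply: HC; rewrite sT (le_trans t0 ts).
Qed.

Lemma sq_integrable_L2_prog k (phi : R -> Omega -> 'cV[R]_k) :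
  L2_prog P F t T phi ->
  sq_integrable_cV PxT (strip Omega t T) (fun z => phi z.2 z.1).
Proof.
move=> [mphi phioo] i; apply: sq_integrable_strip.
  exact: (prog_measurable_strip i 0 (lexx t) tT (filtr_measurable (lexx T)) mphi).
apply: le_lt_trans phioo; apply: nneg_le_integral => w _.
  by apply: integral_ge0 => s _; rewrite lee_fin sqr_ge0.
apply: nneg_le_integral => s _; rewrite lee_fin ?sqr_ge0//.
exact: sqr_coord_le_dotc.
Qed.

Variables (u : R -> Omega -> 'cV[R]_m) (X : R -> Omega -> 'cV[R]_n).
Hypothesis Hu : controls P T W alpha t u.
Hypothesis HX : is_state P T W alpha K t xi vartheta u X.

Let Iu := sq_integrable_L2_prog Hu.
Let IX : sq_integrable_cV PxT (strip Omega t T) (fun z => X z.2 z.1).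
Proof. by apply: sq_integrable_L2_prog; case: HX. Qed.

(** Square integrability of [X] in time and randomness says nothing about a
    single instant; at the horizon it comes from the state equation. *)
Lemma sq_integrable_terminal : sq_integrable_cV P setT (X T).
Proof.
move=> i; have [[mX _] _ _ /(_ T)] := HX.
rewrite tT lexx => /(_ isT)[I ito XE].
apply: (ae_eq_sq_integrable (g := fun w => xi w i 0 +
    \int[lam]_(r in `[t, T]) drift alpha K u X r w i 0 + I w i 0)).
- exact: (prog_measurable_section i 0 tT (filtr_measurable (lexx T)) mX).
- by apply: filterS XE => w -> /=; rewrite !mxE.
apply: sq_integrableD => //; first apply: sq_integrableD => //.
- have [_ [mxi xioo] _] := hD; apply: sq_integrable_lty => //.
    exact: measurable_wrt_measurable (filtr_measurable tT) _ (mxi i).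
  apply: le_lt_trans xioo; apply: nneg_le_integral => w _;
    rewrite lee_fin ?sqr_ge0//.
  exact: sqr_coord_le_dotc.
- have Ib : sq_integrable_cV PxT (strip Omega t T)
      (fun z => drift alpha K u X z.2 z.1).
    have mS := measurable_strip Omega t T.
    apply: sq_integrable_addmx => //; apply: sq_integrable_mulmx => //.
      by apply: bounded_coef_strip; exact: lq_A hK.
    by apply: bounded_coef_strip; exact: lq_B hK.
  exact: (sq_integrable_time_integral (Ib i)).
- have [mI Ioo _] := ito i; apply: sq_integrable_lty => //.
  exact: measurable_wrt_measurable (filtr_measurable (lexx T)) _ mI.
Qed.

Lemma integrable_pathwise_cost :
  P.-integrable setT (EFin \o pathwise_cost T alpha K t u X).
Proof.
have mS := measurable_strip Omega t T.
have IG : P.-integrable setT (EFin \o (fun w =>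
    dotc (cG K (alpha T w) w *m X T w) (X T w))).
  apply: integrable_dotc => //; last exact: sq_integrable_terminal.
  apply: sq_integrable_mulmx => //; last exact: sq_integrable_terminal.
  apply: (bounded_mx_select (a := alpha T) (M := cG K)) => i.
    by rewrite setTI; apply: (mc_measurable halpha); rewrite ltW//= lexx.
  split=> [j k|].
    exact: measurable_wrt_measurable (filtrW_measurable (lexx T)) _
      (lq_G_measurable hK i j k).
  by have [C HC] := lq_G_bounded hK i; exists C => w j k _; exact: HC.
have IQ : PxT.-integrable (strip Omega t T)
    (EFin \o (fun z => running_cost alpha K u X z.2 z.1)).
  have I1 : PxT.-integrable (strip Omega t T) (EFin \o (fun z =>
      dotc (cQ K z.2 (alpha z.2 z.1) z.1 *m X z.2 z.1) (X z.2 z.1))).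
    apply: integrable_dotc => //; apply: sq_integrable_mulmx => //.
    by apply: bounded_coef_strip; exact: lq_Q hK.
  have I2 : PxT.-integrable (strip Omega t T) (EFin \o (fun z =>
      dotc (cS K z.2 (alpha z.2 z.1) z.1 *m X z.2 z.1) (u z.2 z.1))).
    apply: integrable_dotc => //; apply: sq_integrable_mulmx => //.
    by apply: bounded_coef_strip; exact: lq_S hK.
  have I3 : PxT.-integrable (strip Omega t T) (EFin \o (fun z =>
      dotc (cR K z.2 (alpha z.2 z.1) z.1 *m u z.2 z.1) (u z.2 z.1))).
    apply: integrable_dotc => //; apply: sq_integrable_mulmx => //.
    by apply: bounded_coef_strip; exact: lq_R hK.
  exact: (integrableD mS (integrableD mS I1 (integrableZl mS 2 I2)) I3).
exact: (integrableD measurableT IG (integrable_time_integral IQ)).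
Qed.

Lemma is_cond_exp_J : is_cond_exp P (F t) (pathwise_cost T alpha K t u X)
  (J P T W alpha K t u X).
Proof.
have [Y HY] := cond_exp_exists (filtr_measurable tT)
  (filtr_sigma_algebra P W alpha t) integrable_pathwise_cost.
rewrite /J /cond_exp; case: xgetP => [Z _ //|/(_ Y)]; contradiction.
Qed.

End cost_integrability.

(** * Equivalence of the two problems *)

Theorem proposition3p6 (R : realType) (d : measure_display)
    (Omega : measurableType d) (P : probability Omega R)
    (hP : measure_is_complete P)
    (T : R) (hT : 0 < T)
    (n m L : nat) (hn : (0 < n)%N) (hm : (0 < m)%N) (hL : (0 < L)%N)
    (W : R -> Omega -> R) (hW : brownian_motion P T W)
    (lambda : R -> 'M[R]_L) (alpha : R -> Omega -> 'I_L)
    (halpha : markov_chain P T alpha lambda)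
    (hindep : independent_drivers P T W alpha)
    (K : lq_data R Omega n m L) (hK : lq_assumptions P T W K)
    (t : R) (xi : Omega -> 'cV[R]_n) (vartheta : Omega -> 'I_L)
    (hD : initial_triple P T W alpha t xi vartheta)
    (us : R -> Omega -> 'cV[R]_m) (hus : controls P T W alpha t us) :
  optimal_MSLQ0 P T W alpha K t xi vartheta us <->
  optimal_MSLQ P T W alpha K t xi vartheta us.
Proof.
have tT : t <= T by have [/andP[]] := hD.
have FM := filtr_measurable hP hW halpha tT.
have sF := filtr_sigma_algebra P W alpha t.
have Ic := integrable_pathwise_cost hP hT hW halpha hK hD.
have HJ := is_cond_exp_J hP hT hW halpha hK hD.
split=> -[_ [Xs sXs opt]]; split=> //; exists Xs => // u X cu sX; last first.
  by apply: (ae_le_cond_exp_expectation sF (HJ _ _ hus sXs) (HJ _ _ cu sX));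
    exact: opt.
have FA := cond_exp_lt_set sF (HJ _ _ hus sXs) (HJ _ _ cu sX).
have mA := FM _ FA.
apply: (glue_expectation_le_cond_exp_ae sF FM (Ic _ _ hus sXs) (Ic _ _ cu sX)
  (HJ _ _ hus sXs) (HJ _ _ cu sX)).
have := opt _ _ (L2_prog_glue FA mA cu hus) (is_state_glue FA mA sX sXs).
by rewrite /J0 pathwise_cost_glue.
Qed.
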